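(* If there is an output-polynomial time algorithm for Group Steiner Tree Enumeration, then there is an output-polynomial time algorithm for Minimal Transversal Enumeration.
   Context: Group Steiner Tree Enumeration: given an undirected graph $G=(V,E)$ and terminal sets $W_1,\dots,W_s\subseteq V$, output, each exactly once, all inclusion-minimal subgraphs of $G$ that contain a $W_i$-$W_j$ path for every $1\le i<j\le s$ (a $W_i$-$W_j$ path being a path with one end in $W_i$ and the other end in $W_j$). Minimal Transversal Enumeration: given a hypergraph $\mathcal H=(U,\mathcal E)$, output all inclusion-minimal sets $X\subseteq U$ with $X\cap e\neq\emptyset$ for every $e\in\mathcal E$. An enumeration algorithm is output-polynomial if its total running time is bounded by a polynomial in the input size plus the number of solutions. *)

(* Defs.v *)
From mathcomp Require Import all_boot all_order all_algebra.

Set Implicit Arguments.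
Unset Strict Implicit.
Unset Printing Implicit Defensive.

(* Multi-tape Turing machines with a write-only output tape.  Words are over
   the alphabet {0, 1, #, ;}; '#' closes a row of bits and ';' closes a
   solution in the output. *)

Inductive symbol := Bit of bool | Hash | Semi.

Inductive move := MoveL | Stay | MoveR.

(* [None] is the blank; [work] collects the machine's own tape symbols. *)
Definition cell (work : finType) : Type := option (symbol + work).

(* [tm_trans q a] is [None] when the machine halts; otherwise it gives the next
   state, what to write and how to move on each tape, and the symbol to be
   appended to the output, if any. *)
Record machine := Machine {
  tm_state : finType;
  tm_work : finType;
  tm_extra : nat; (* number of tapes besides the input tape, which is [ord0] *)
  tm_start : tm_state;
  tm_trans : tm_state -> {ffun 'I_tm_extra.+1 -> cell tm_work} ->
    option (tm_state * {ffun 'I_tm_extra.+1 -> cell tm_work * move}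
            * option symbol)
}.

Section Semantics.
Variable M : machine.

(* A two-way infinite tape, indexed relatively to the head, which scans cell 0. *)
Definition tape := int -> cell (tm_work M).

Definition tape_write (a : cell (tm_work M)) (t : tape) : tape :=
  fun i => if i == 0%R then a else t i.

Definition tape_move (d : move) (t : tape) : tape :=
  match d with
  | MoveL => fun i => t (i - 1)%R
  | Stay => t
  | MoveR => fun i => t (i + 1)%R
  end.

Record config := Config {
  cf_state : tm_state M;
  cf_tapes : 'I_(tm_extra M).+1 -> tape;
  cf_out : seq symbol
}.

Definition tm_action (c : config) :=
  tm_trans (cf_state c) [ffun k => cf_tapes c k 0%R].

Definition halted (c : config) : bool := ~~ isSome (tm_action c).

Definition step (c : config) : config :=
  match tm_action c with
  | None => c
  | Some (q, act, o) =>
      Config q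
        (fun k => tape_move (act k).2 (tape_write (act k).1 (cf_tapes c k)))
        (cf_out c ++ oapp (fun a => [:: a]) [::] o)
  end.

Definition input_tape (w : seq symbol) : tape := fun i =>
  match i with
  | Posz n => nth None [seq Some (inl a) | a <- w] n
  | Negz _ => None
  end.

Definition init (w : seq symbol) : config :=
  Config (tm_start M)
    (fun k => if k == ord0 then input_tape w else fun=> None) [::].

Definition computes_within (w : seq symbol) (t : nat) (v : seq symbol) : Prop :=
  let c := iter t step (init w) in halted c /\ cf_out c = v.

End Semantics.

Record enum_problem := EnumProblem {
  instance : Type;
  object : instance -> eqType;
  is_solution : forall x : instance, object x -> Prop;
  encode_instance : instance -> seq symbol;
  encode_object : forall x : instance, object x -> seq symbol
}.

(* [s] lists the solutions of [x] without repetition, so [size s] is the number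
   of solutions; their order is left to the machine. *)
Definition output_polynomial_algorithm (P : enum_problem) (M : machine) : Prop :=
  exists p : {poly nat}, forall x : instance P,
    exists s : seq (object x),
      [/\ uniq s,
          forall y : object x, y \in s <-> is_solution y &
          exists2 t : nat,
            t <= p.[(size (encode_instance x) + size s)%N]%R &
            computes_within M (encode_instance x) t
              (flatten [seq encode_object y | y <- s])].

Definition has_output_polynomial_algorithm (P : enum_problem) : Prop :=
  exists M : machine, output_polynomial_algorithm P M.

Definition encode_row n (A : {set 'I_n}) : seq symbol :=
  rcons [seq Bit (i \in A) | i <- enum 'I_n] Hash.

Definition encode_order (n : nat) : seq symbol := rcons (nseq n (Bit true)) Hash.

(* Finite simple undirected graphs on the vertex set 'I_n. *)
Record graph (n : nat) := Graph {
  edges :> {set {set 'I_n}};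
  edges_card2 : forall e, e \in edges -> #|e| = 2
}.

(* Adjacency matrix of a set of edges. *)
Definition encode_edges n (E : {set {set 'I_n}}) : seq symbol :=
  flatten [seq encode_row [set j | [set i; j] \in E] | i <- enum 'I_n].

(* A pair of a vertex set and an edge set. *)
Definition pregraph (n : nat) := ({set 'I_n} * {set {set 'I_n}})%type.

Definition is_subgraph n (G : graph n) (H : pregraph n) : Prop :=
  H.2 \subset edges G /\ (forall e, e \in H.2 -> e \subset H.1).

Definition pregraph_sub n (H K : pregraph n) : bool :=
  (H.1 \subset K.1) && (H.2 \subset K.2).

(* The path may consist of a single vertex of [A :&: B]. *)
Definition contains_path n (H : pregraph n) (A B : {set 'I_n}) : Prop :=
  exists x p,
    [/\ x \in A, last x p \in B, uniq (x :: p), {subset x :: p <= H.1} &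
        path (fun u v => [set u; v] \in H.2) x p].

Record gst_instance := GSTInstance {
  gst_order : nat;
  gst_graph : graph gst_order;
  gst_terminals : seq {set 'I_gst_order}
}.

Definition group_connecting (I : gst_instance) (H : pregraph (gst_order I)) :
    Prop :=
  is_subgraph (gst_graph I) H /\
  forall i j, i < j < size (gst_terminals I) ->
    contains_path H (nth set0 (gst_terminals I) i) (nth set0 (gst_terminals I) j).

Definition minimal_group_connecting (I : gst_instance)
    (H : pregraph (gst_order I)) : Prop :=
  group_connecting H /\
  forall K : pregraph (gst_order I),
    group_connecting K -> pregraph_sub K H -> K = H.

Definition GroupSteinerTreeEnumeration : enum_problem := {|
  instance := gst_instance;
  object := fun I => pregraph (gst_order I);
  is_solution := minimal_group_connecting;
  encode_instance := fun I =>
    encode_order (gst_order I) ++ encode_edges (gst_graph I)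
      ++ flatten [seq encode_row W | W <- gst_terminals I];
  encode_object := fun I H =>
    encode_row H.1 ++ encode_edges H.2 ++ [:: Semi]
|}.

(* A hypergraph on 'I_n is presented by a list of its hyperedges. *)
Record hypergraph := Hypergraph {
  hg_order : nat;
  hyperedges : seq {set 'I_hg_order};
  hyperedges_uniq : uniq hyperedges
}.

Definition hg_transversal (H : hypergraph) (X : {set 'I_(hg_order H)}) : bool :=
  all (fun e => X :&: e != set0) (hyperedges H).

Definition MinimalTransversalEnumeration : enum_problem := {|
  instance := hypergraph;
  object := fun H => {set 'I_(hg_order H)};
  is_solution := fun H X => minset (@hg_transversal H) X;
  encode_instance := fun H =>
    encode_order (hg_order H) ++ flatten [seq encode_row e | e <- hyperedges H];
  encode_object := fun H X => encode_row X ++ [:: Semi]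
|}.

(* Main.v *)
(** Attach every element of the hypergraph as a leaf to a new centre and take as
terminal sets the centre alone and the hyperedges.  A subgraph of this star
connects all terminal sets exactly when the leaves joined to the centre form a
transversal, so the minimal connecting subgraphs are the stars over the minimal
transversals.  The machine for transversals writes the encoding of the star
instance on its second tape, in quadratic time, then runs the given machine
there; a three-state filter turns each printed subgraph into the row of its
leaves. *)

Require Import Defs.
From HB Require Import structures.
From Stdlib Require Import FunctionalExtensionality.
From mathcomp Require Import all_boot all_order all_algebra.
From mathcomp Require Import zify.

Set Implicit Arguments.
Unset Strict Implicit.
Unset Printing Implicit Defensive.

(** * Runs and tapes *)

Definition reaches (M : machine) (k : nat) (c c' : config M) : Prop :=
  exists2 t, t <= k & iter t (@step M) c = c'.

Lemma reaches_refl (M : machine) (c : config M) : reaches 0 c c.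
Proof. by exists 0. Qed.

Lemma reaches_trans (M : machine) k l (c d e : config M) :
  reaches k c d -> reaches l d e -> reaches (k + l) c e.
Proof.
move=> [t tk <-] [u ul <-]; exists (u + t); last by rewrite iterD.
by rewrite addnC leq_add.
Qed.

Lemma reaches_step (M : machine) k (c d : config M) :
  reaches k (step c) d -> reaches k.+1 c d.
Proof. by move=> [t tk <-]; exists t.+1; rewrite // iterSr. Qed.

Lemma reaches_le (M : machine) k l (c d : config M) :
  k <= l -> reaches k c d -> reaches l c d.
Proof. by move=> kl [t tk <-]; exists t => //; apply: leq_trans kl. Qed.

Definition sym (work : finType) (a : symbol) : cell work := Some (inl a).
Arguments sym {work} a.

Section Tapes.
Variable M : machine.

Definition act (a : cell (tm_work M) * move) (t : tape M) : tape M :=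
  tape_move a.2 (tape_write a.1 t).

(** [l] lists the cells left of the head, nearest first, and [r] starts at the scanned cell; all
    cells beyond are blank. *)
Definition zipper (l r : seq (cell (tm_work M))) : tape M := fun i =>
  match i with
  | Posz n => nth None r n
  | Negz n => nth None l n
  end.

Lemma act_right a l r :
  act (a, MoveR) (zipper l r) = zipper (a :: l) (behead r).
Proof.
apply: functional_extensionality => -[n|[|n]]; rewrite /act /tape_write /=.
- by rewrite addn1 nth_behead; case: eqP => //; lia.
- by [].
- by rewrite subn1.
Qed.

Lemma act_left a l r :
  act (a, MoveL) (zipper l r) = zipper (behead l) (head None l :: a :: behead r).
Proof.
apply: functional_extensionality => -[[|[|n]]|n]; rewrite /act /tape_write /=.
- by case: l.
- by [].
- by rewrite subn1 nth_behead.
- by rewrite addn0 nth_behead.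
Qed.

Lemma act_stay (t : tape M) : act (t 0%R, Stay) t = t.
Proof.
apply: functional_extensionality => i; rewrite /act /tape_write /=.
by case: eqP => // ->.
Qed.

Lemma zipper_trail l r : zipper l (rcons r None) = zipper l r.
Proof.
apply: functional_extensionality => -[n|n] //=.
rewrite nth_rcons; case: ltngtP => // [nr|->]; last by rewrite nth_default.
by rewrite nth_default // ltnW.
Qed.

Lemma zipper_lead r : zipper [:: None] r = zipper [::] r.
Proof.
by apply: functional_extensionality => -[n|[|n]] //=; rewrite nth_nil.
Qed.

Definition word_tape (u v : seq symbol) : tape M :=
  zipper (rev (map sym u)) (map sym v).

(* The head stands one cell to the left of the first letter of [v]. *)
Definition left_of (v : seq symbol) : tape M := zipper [::] (None :: map sym v).

(** The tape one left move away from [word_tape u v]. For empty [u] the head falls on the blank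
    before the word, which is what ends the leftward loops. *)
Definition step_left (u v : seq symbol) : tape M :=
  if u is a :: u' then word_tape (belast a u') (last a u' :: v) else left_of v.

Lemma step_left_rcons u a v : step_left (rcons u a) v = word_tape u (a :: v).
Proof. by case: u => [|b u] //=; rewrite belast_rcons last_rcons. Qed.

Lemma word_tape_write u v a b :
  act (sym b, MoveR) (word_tape u (a :: v)) = word_tape (rcons u b) v.
Proof. by rewrite act_right /word_tape map_rcons rev_rcons. Qed.

Lemma word_tape_append u b :
  act (sym b, MoveR) (word_tape u [::]) = word_tape (rcons u b) [::].
Proof. by rewrite act_right /word_tape map_rcons rev_rcons. Qed.

Lemma word_tape_left u a v :
  act (sym a, MoveL) (word_tape u (a :: v)) = step_left u (a :: v).
Proof.
elim/last_ind: u => [|u b _]; first by rewrite act_left.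
by rewrite act_left step_left_rcons /word_tape map_rcons rev_rcons.
Qed.

Lemma word_tape_end_left u :
  act (None, MoveL) (word_tape u [::]) = step_left u [::].
Proof.
elim/last_ind: u => [|u b _].
  by rewrite act_left; apply: (zipper_trail [::] [:: None]).
rewrite act_left step_left_rcons /word_tape map_rcons rev_rcons.
exact: (zipper_trail _ [:: sym b]).
Qed.

Lemma left_of_right v : act (None, MoveR) (left_of v) = word_tape [::] v.
Proof. by rewrite act_right zipper_lead. Qed.

Lemma input_tapeE w : input_tape M w = word_tape [::] w.
Proof. by apply: functional_extensionality => -[n|n] //=; rewrite nth_nil. Qed.

Lemma blank_tapeE : (fun=> None : cell (tm_work M)) = word_tape [::] [::].
Proof. by apply: functional_extensionality => -[n|n] //=; rewrite nth_nil. Qed.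

End Tapes.

(** * The reduction machine *)

(* Over an input [1^n # rows], the word written on the second tape is
   [1 1^n # 0 1^n #], then [n.+1] copies of [1 0^n #], then each row preceded
   by [0].  The blocks [c b^n #] are produced by one sweep of the head over
   [1^n #], in the phase [(c, b)].  Phase [(true, false)] is repeated: each sweep
   turns the first remaining [1] of the input into [0], and the sweep that finds
   none is the last one. *)
Inductive phase_state :=
  | Prefix of bool & bool
  | Sweep of bool & bool & bool (* the last flag: a [1] has been erased *)
  | Return of bool & bool
  | RowStart
  | RowCopy
  | Rewind.

Definition phase_encode q : (bool * bool) + (bool * bool * bool) +
    (bool * bool) + 'I_3 :=
  match q with
  | Prefix c b => inl (inl (inl (c, b)))
  | Sweep c b m => inl (inl (inr (c, b, m)))
  | Return c b => inl (inr (c, b))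
  | RowStart => inr (inord 0)
  | RowCopy => inr (inord 1)
  | Rewind => inr (inord 2)
  end.

Definition phase_decode (x : (bool * bool) + (bool * bool * bool) +
    (bool * bool) + 'I_3) : phase_state :=
  match x with
  | inl (inl (inl (c, b))) => Prefix c b
  | inl (inl (inr (c, b, m))) => Sweep c b m
  | inl (inr (c, b)) => Return c b
  | inr i => nth RowStart [:: RowStart; RowCopy; Rewind] i
  end.

Lemma phase_encodeK : cancel phase_encode phase_decode.
Proof. by case=> //=; rewrite inordK. Qed.

HB.instance Definition _ := Finite.copy phase_state (can_type phase_encodeK).

(* [Head] skips the bit of the centre of the star, [Copy] copies the bits of the
   leaves, [Skip] drops the adjacency matrix. *)
Inductive filter_state := Head | Copy | Skip.

Definition filter_encode q : 'I_3 :=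
  match q with Head => inord 0 | Copy => inord 1 | Skip => inord 2 end.

Definition filter_decode (i : 'I_3) := nth Head [:: Head; Copy; Skip] i.

Lemma filter_encodeK : cancel filter_encode filter_decode.
Proof. by case; rewrite /filter_decode inordK. Qed.

HB.instance Definition _ := Finite.copy filter_state (can_type filter_encodeK).

Definition filter_next (q : filter_state) (a : symbol) : filter_state :=
  match q, a with
  | Head, _ => Copy
  | Copy, Hash => Skip
  | Skip, Semi => Head
  | _, _ => q
  end.

Definition filter_emit (q : filter_state) (a : symbol) : option symbol :=
  match q, a with
  | Head, _ => None
  | Copy, _ => Some a
  | Skip, Semi => Some Semi
  | Skip, _ => None
  end.

Definition filter_step (x : filter_state * seq symbol) (a : symbol) :=
  (filter_next x.1 a,
   x.2 ++ oapp (fun b => [:: b]) [::] (filter_emit x.1 a)).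

Definition filter_word (w : seq symbol) : filter_state * seq symbol :=
  foldl filter_step (Head, [::]) w.

Lemma filter_word_rcons w a :
  filter_word (rcons w a) = filter_step (filter_word w) a.
Proof. by rewrite /filter_word -cats1 foldl_cat. Qed.

Definition bit_row (s : seq bool) : seq symbol := rcons (map Bit s) Hash.

Section Machine.
Variable M : machine.

Notation mcell := (cell (tm_work M)).

(* [None] as next state: the simulation of [M] may start. *)
Definition phase_trans (q : phase_state) (x y : mcell) :
    option phase_state * (mcell * move) * (mcell * move) :=
  match q with
  | Prefix c b => (Some (Sweep c b false), (x, Stay), (sym (Bit c), MoveR))
  | Sweep c b m =>
      if x is Some (inl (Bit d)) then
        if [|| b, m | ~~ d] then
          (Some (Sweep c b m), (x, MoveR), (sym (Bit b), MoveR))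
        else (Some (Sweep c b true), (sym (Bit false), MoveR),
              (sym (Bit b), MoveR))
      else if b || m then
        (Some (Return (~~ (c && b)) (c && b)), (x, MoveL), (sym Hash, MoveR))
      else (Some RowStart, (x, MoveR), (sym Hash, MoveR))
  | Return c b =>
      if x is None then (Some (Prefix c b), (None, MoveR), (y, Stay))
      else (Some q, (x, MoveL), (y, Stay))
  | RowStart =>
      if x is None then (Some Rewind, (x, Stay), (y, MoveL))
      else (Some RowCopy, (x, Stay), (sym (Bit false), MoveR))
  | RowCopy =>
      (Some (if x is Some (inl Hash) then RowStart else RowCopy),
       (x, MoveR), (x, MoveR))
  | Rewind =>
      if y is None then (None, (x, Stay), (None, MoveR))
      else (Some Rewind, (x, Stay), (y, MoveL))
  end.

Definition reduction_state : finType := (phase_state + tm_state M * filter_state)%type.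

Definition sim_start : reduction_state := inr (tm_start M, Head).

(** Tape [k] of [M] is tape [lift ord0 k] of the new machine, so this is the input tape of [M]. *)
Definition second_tape : 'I_(tm_extra M).+2 := lift ord0 ord0.

Definition reduction_trans (q : reduction_state)
    (f : {ffun 'I_(tm_extra M).+2 -> mcell}) :
    option (reduction_state * {ffun 'I_(tm_extra M).+2 -> mcell * move}
            * option symbol) :=
  match q with
  | inl p =>
      let: (p', a, b) := phase_trans p (f ord0) (f second_tape) in
      Some (oapp inl sim_start p',
            [ffun k => if k == ord0 then a
                       else if k == second_tape then b else (f k, Stay)], None)
  | inr (q, s) =>
      if tm_trans q [ffun k => f (lift ord0 k)] is Some (q', a, o) then
        Some (inr (q', if o is Some x then filter_next s x else s),
              [ffun k => if unlift ord0 k is Some j then a j else (f k, Stay)],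
              if o is Some x then filter_emit s x else None)
      else None
  end.

Definition reduction_machine : machine :=
  @Machine reduction_state (tm_work M) (tm_extra M).+1
    (inl (Prefix true true)) reduction_trans.

Local Notation R := reduction_machine.

(** The configurations of the writing phases: all other tapes are still blank and nothing has been
    printed. *)
Definition two_tapes (q : reduction_state) (A B : tape R) : config R :=
  @Config R q (fun k : 'I_(tm_extra M).+2 =>
    if k == ord0 then A else if k == second_tape then B else fun=> None) [::].

Lemma step_two_tapes p A B p' a b :
  phase_trans p (A 0%R) (B 0%R) = (p', a, b) ->
  step (two_tapes (inl p) A B) =
    two_tapes (oapp inl sim_start p') (act (M := R) a A) (act (M := R) b B).
Proof.
move=> E; rewrite /step /tm_action /= !ffunE /= E /two_tapes; congr Config.
apply: functional_extensionality => k; rewrite !ffunE.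
case: eqP => [//|_]; case: eqP => [//|_].
exact: (act_stay (M := R) (fun=> None)).
Qed.

Lemma reaches_two_tapes k p A B p' a b c :
  phase_trans p (A 0%R) (B 0%R) = (p', a, b) ->
  reaches k (two_tapes (oapp inl sim_start p')
               (act (M := R) a A) (act (M := R) b B)) c ->
  reaches k.+1 (two_tapes (inl p) A B) c.
Proof. by move=> E H; apply: reaches_step; rewrite (step_two_tapes E). Qed.

Local Notation rd := (word_tape R).

Lemma return_run c b u v B :
  reaches (size u).+1 (two_tapes (inl (Return c b)) (step_left R u v) B)
    (two_tapes (inl (Prefix c b)) (rd [::] (u ++ v)) B).
Proof.
elim/last_ind: u v => [|u a IH] v.
  apply: reaches_two_tapes => //=.
  by rewrite left_of_right act_stay; apply: reaches_refl.
rewrite step_left_rcons size_rcons.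
apply: reaches_two_tapes => //=.
by rewrite word_tape_left act_stay cat_rcons; apply: IH.
Qed.

Lemma rewind_run A u v :
  reaches (size u).+1 (two_tapes (inl Rewind) A (step_left R u v))
    (two_tapes sim_start A (rd [::] (u ++ v))).
Proof.
elim/last_ind: u v => [|u a IH] v.
  apply: reaches_two_tapes => //=.
  by rewrite left_of_right act_stay; apply: reaches_refl.
rewrite step_left_rcons size_rcons.
apply: reaches_two_tapes => //=.
by rewrite word_tape_left act_stay cat_rcons; apply: IH.
Qed.

(** The hypothesis ensures that no [1] is erased: [b] marks a phase without erasing, [m] an erasure
    already made, and failing both no [1] is left in [s]. *)
Lemma sweep_idle c b m s u v w :
  [|| b, m | ~~ has id s] ->
  reaches (size s) (two_tapes (inl (Sweep c b m)) (rd u (map Bit s ++ v)) (rd w [::]))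
    (two_tapes (inl (Sweep c b m)) (rd (u ++ map Bit s) v)
       (rd (w ++ nseq (size s) (Bit b)) [::])).
Proof.
elim: s u w => [|d s IH] u w H /=; first by rewrite !cats0; apply: reaches_refl.
have Hd : [|| b, m | ~~ d] by move: H => /=; case: (b) (m) (d) => [] [] [].
apply: reaches_two_tapes; first by rewrite /= Hd.
rewrite word_tape_write word_tape_append -!cat_rcons /=; apply: IH.
by move: H => /=; case: (b) (m) (d) => [] [] [].
Qed.

Lemma prefix_run k c b A w t :
  reaches k (two_tapes (inl (Sweep c b false)) A (rd (rcons w (Bit c)) [::])) t ->
  reaches k.+1 (two_tapes (inl (Prefix c b)) A (rd w [::])) t.
Proof.
move=> H; apply: reaches_two_tapes => //=.
by rewrite act_stay word_tape_append.
Qed.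

(** The formulas in [c && b] run through the phases [(true, true)], [(false, true)], [(true, false)]
    and then stay at the last one. *)
Lemma turn_run c b m s v w : b || m ->
  reaches (size s).+2
    (two_tapes (inl (Sweep c b m)) (rd (map Bit s) (Hash :: v)) (rd w [::]))
    (two_tapes (inl (Prefix (~~ (c && b)) (c && b)))
       (rd [::] (bit_row s ++ v)) (rd (rcons w Hash) [::])).
Proof.
move=> H; apply: reaches_two_tapes; first by rewrite /= H.
rewrite word_tape_left word_tape_append /bit_row cat_rcons -(size_map Bit s).
exact: return_run.
Qed.

Lemma block_run c n v w :
  reaches (2 * n + 3)
    (two_tapes (inl (Prefix c true)) (rd [::] (bit_row (nseq n true) ++ v)) (rd w [::]))
    (two_tapes (inl (Prefix (~~ c) c)) (rd [::] (bit_row (nseq n true) ++ v))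
       (rd (w ++ bit_row (c :: nseq n true)) [::])).
Proof.
have -> : 2 * n + 3 = (n + n.+2).+1 by lia.
apply: prefix_run.
have := @sweep_idle c true false (nseq n true) [::] (Hash :: v)
  (rcons w (Bit c)) isT.
rewrite -cat_rcons size_nseq => /reaches_trans; apply.
have := @turn_run c true false (nseq n true) v
  (rcons w (Bit c) ++ nseq n (Bit true)) isT.
by rewrite andbT size_nseq /bit_row !cat_rcons -!cats1 /= map_nseq -!catA.
Qed.

(** The input row serves as a unary counter with [i] letters erased and [j] remaining. Each of the
    [j] erasing sweeps yields a block; the sweep that finds nothing to erase yields one more and
    stops behind the row instead of returning. *)
Lemma loop_run i j v w :
  reaches (j.+1 * (2 * (i + j) + 3))
    (two_tapes (inl (Prefix true false))
       (rd [::] (bit_row (nseq i false ++ nseq j true) ++ v)) (rd w [::]))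
    (two_tapes (inl RowStart) (rd (bit_row (nseq (i + j) false)) v)
       (rd (w ++ flatten (nseq j.+1 (bit_row (true :: nseq (i + j) false)))) [::])).
Proof.
elim: j i w => [|j IH] i w.
  rewrite addn0 mul1n cats0.
  rewrite addnS.
  apply: prefix_run; apply: (reaches_le (k := i + 1)); first by lia.
  have := @sweep_idle true false false (nseq i false) [::] (Hash :: v)
    (rcons w (Bit true)).
  rewrite -cat_rcons size_nseq has_nseq andbF => /(_ isT) /reaches_trans; apply.
  apply: reaches_two_tapes => //=.
  rewrite word_tape_write word_tape_append /bit_row /=.
  rewrite cats0 !cat_rcons -!cats1 /= map_nseq -!catA.
  exact: reaches_refl.
rewrite mulSn; apply: reaches_trans; last first.
  have := IH i.+1 (w ++ bit_row (true :: nseq (i + j.+1) false)).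
  rewrite addSnnS -catA; apply.
(* One step for the prefix bit, [i] over erased letters, one erasing, [j] over the remaining ones,
   then the turn back over the whole row. *)
have -> : 2 * (i + j.+1) + 3 = (i + (j + (i + j.+1).+2).+1).+1 by lia.
apply: prefix_run.
have := @sweep_idle true false false (nseq i false) [::]
  (map Bit (nseq j.+1 true) ++ Hash :: v) (rcons w (Bit true)).
rewrite catA -map_cat -cat_rcons size_nseq has_nseq andbF.
move=> /(_ isT) /reaches_trans; apply.
apply: reaches_two_tapes => //=.
rewrite word_tape_write word_tape_append.
have := @sweep_idle true false true (nseq j true)
  (rcons (map Bit (nseq i false)) (Bit false)) (Hash :: v)
  (rcons (rcons w (Bit true) ++ nseq i (Bit false)) (Bit false)) isT.
rewrite size_nseq => /reaches_trans; apply.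
have := @turn_run true false true (nseq i.+1 false ++ nseq j true) v
  ((rcons (rcons w (Bit true) ++ nseq i (Bit false)) (Bit false)) ++
   nseq j (Bit false)) isT.
rewrite size_cat !size_nseq addSnnS.
have rcons_nseq (T : Type) (x : T) : rcons (nseq i x) x = nseq i.+1 x.
  by rewrite -cats1 -[[:: x]]/(nseq 1 x) -nseqD addn1.
have -> : w ++ bit_row (true :: nseq (i + j.+1) false) =
    rcons (rcons (rcons w (Bit true) ++ nseq i (Bit false)) (Bit false) ++
           nseq j (Bit false)) Hash.
  by rewrite /bit_row /= map_nseq nseqD /= -!cats1 -!catA.
by rewrite -[in X in _ -> X]map_rcons rcons_nseq -map_cat.
Qed.

Lemma copy_run s u v w :
  reaches (size s).+1
    (two_tapes (inl RowCopy) (rd u (bit_row s ++ v)) (rd w [::]))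
    (two_tapes (inl RowStart) (rd (u ++ bit_row s) v)
       (rd (w ++ bit_row s) [::])).
Proof.
elim: s u w => [|d s IH] u w /=; apply: reaches_two_tapes => //=.
  by rewrite word_tape_write word_tape_append !cats1; apply: reaches_refl.
by rewrite word_tape_write word_tape_append -!cat_rcons; apply: IH.
Qed.

(** The inserted [0] is the bit of the centre, which lies in no hyperedge. It costs one more step
    per row, absorbed by the factor two because each row has at least its [Hash]. *)
Lemma rows_run (rows : seq (seq bool)) u w :
  reaches (2 * size (flatten (map bit_row rows)) + 1)
    (two_tapes (inl RowStart) (rd u (flatten (map bit_row rows))) (rd w [::]))
    (two_tapes (inl Rewind) (rd (u ++ flatten (map bit_row rows)) [::])
       (step_left R (w ++ flatten [seq bit_row (false :: s) | s <- rows]) [::])).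
Proof.
elim: rows u w => [|s rows IH] u w /=.
  rewrite !cats0; apply: reaches_two_tapes => //=.
  by rewrite act_stay word_tape_end_left; apply: reaches_refl.
have H := @copy_run s u (flatten (map bit_row rows)) (rcons w (Bit false)).
have := reaches_trans H (IH _ _); rewrite -!catA cat_rcons => {}H.
apply: reaches_le; last first.
  (* The scanned letter is a bit or [Hash] depending on [s], so the cell written back is given as
     the scanned one. *)
  apply: (reaches_two_tapes (p' := Some RowCopy)
    (a := (rd u (bit_row s ++ flatten (map bit_row rows)) 0%R, Stay))
    (b := (sym (Bit false), MoveR))); first by case: (s).
  by rewrite act_stay word_tape_append; apply: H.
rewrite size_cat size_rcons size_map; lia.
Qed.

(** In order: the number of vertices; the adjacency row of the centre; the [n] adjacency rows of the
    leaves and the terminal set of the centre alone, all the same word; the hyperedges. *)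
Definition reduced_word n (rows : seq (seq bool)) : seq symbol :=
  bit_row (true :: nseq n true) ++ bit_row (false :: nseq n true) ++
  flatten (nseq n.+1 (bit_row (true :: nseq n false))) ++
  flatten [seq bit_row (false :: s) | s <- rows].

(** Only the [n.+1] equal blocks are quadratic; one extra bit per row at most doubles the rows. *)
Lemma size_reduced_word n rows N :
  N = size (bit_row (nseq n true) ++ flatten (map bit_row rows)) ->
  size (reduced_word n rows) <= 3 * (N + 1) ^ 2.
Proof.
rewrite /reduced_word !size_cat !size_rcons /= !size_map !size_nseq => ->.
have -> : size (flatten (nseq n (bit_row (true :: nseq n false)))) = n * n.+2.
  rewrite size_flatten /shape map_nseq sumn_nseq.
  by rewrite size_rcons /= size_map size_nseq mulnC.
have : size (flatten [seq bit_row (false :: s) | s <- rows]) <=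
       2 * size (flatten (map bit_row rows)).
  elim: rows => //= s rows IH; rewrite !size_cat !size_rcons /= size_map; lia.
nia.
Qed.

Lemma reduction_run n rows N :
  N = size (bit_row (nseq n true) ++ flatten (map bit_row rows)) ->
  exists A, reaches (8 * (N + 1) ^ 2)
    (init R (bit_row (nseq n true) ++ flatten (map bit_row rows)))
    (two_tapes sim_start A (rd [::] (reduced_word n rows))).
Proof.
move=> EN; set v := flatten _ in EN *.
(* The used-up input: the counter is erased and the head is past the end. The simulation never reads
   this tape. *)
exists (rd (bit_row (nseq n false) ++ v) [::]).
have -> : init R (bit_row (nseq n true) ++ v) =
    two_tapes (inl (Prefix true true))
      (rd [::] (bit_row (nseq n true) ++ v)) (rd [::] [::]).
  rewrite /init /two_tapes -input_tapeE -blank_tapeE; congr Config.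
  by apply: functional_extensionality => k; case: eqP => // _; case: eqP.
have H := reaches_trans (@block_run true n v [::]) (@block_run false n v _).
have {}H := reaches_trans H (@loop_run 0 n v _).
have {}H := reaches_trans H (@rows_run rows _ _).
have := reaches_trans H (@rewind_run _ _ [::]).
have catE (a b c d : seq symbol) : ((a ++ b) ++ c) ++ d = a ++ b ++ c ++ d.
  by rewrite -!catA.
rewrite add0n cats0 cat0s catE -/(reduced_word n rows).
apply: reaches_le.
have := size_reduced_word EN.
move: EN; rewrite size_cat size_rcons size_map size_nseq -/v.
nia.
Qed.

(** The filter emits at most one symbol per symbol printed by [M], so it fits in the finite control
    and both machines run in lockstep. *)
Lemma reduction_simulates A w t :
  let c := iter t (@step M) (init M w) in
  let d := iter t (@step R) (two_tapes sim_start A (rd [::] w)) in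
  [/\ cf_state d = inr (cf_state c, (filter_word (cf_out c)).1),
      forall k, cf_tapes d (lift ord0 k) = cf_tapes c k &
      cf_out d = (filter_word (cf_out c)).2].
Proof.
elim: t => [|t IH].
  split=> //= k.
  rewrite (inj_eq lift_inj) (input_tapeE M).
  by case: eqP.
rewrite !iterS; move: (iter t _ _) (iter t _ _) IH => d c /= [Eq Et Eo].
have Er : [ffun k => [ffun k => cf_tapes d k 0%R] (lift ord0 k)] =
          [ffun k => cf_tapes c k 0%R].
  by apply/ffunP=> k; rewrite !ffunE Et.
rewrite /step /tm_action /= Eq /= Er.
case: (tm_trans _ _) => [[[q a] o]|] /=; last by rewrite Eq.
split.
- by case: o => [x|] /=; rewrite ?cats0 // cats1 filter_word_rcons.
- by move=> k; rewrite ffunE liftK Et.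
- by case: o => [x|] /=; rewrite ?cats0 // cats1 filter_word_rcons Eo.
Qed.

Lemma reduction_halts A w t :
  halted (iter t (@step M) (init M w)) ->
  halted (iter t (@step R) (two_tapes sim_start A (rd [::] w))).
Proof.
have [Eq Et _] := reduction_simulates A w t.
rewrite /halted /tm_action; move: Eq Et.
move: (iter t (@step M) _) (iter t _ _) => c d Eq Et.
rewrite /= Eq /=.
have -> : [ffun k => [ffun k => cf_tapes d k 0%R] (lift ord0 k)] =
          [ffun k => cf_tapes c k 0%R].
  by apply/ffunP=> k; rewrite !ffunE Et.
by case: (tm_trans _ _) => [[[]]|].
Qed.

Lemma reduction_computes n rows N t v :
  N = size (bit_row (nseq n true) ++ flatten (map bit_row rows)) ->
  computes_within M (reduced_word n rows) t v ->
  exists2 t', t' <= 8 * (N + 1) ^ 2 + t &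
    computes_within R (bit_row (nseq n true) ++ flatten (map bit_row rows)) t'
      (filter_word v).2.
Proof.
move=> /reduction_run [A [t0 t0N E0]] [Hh Ho].
exists (t + t0); first by rewrite addnC leq_add2r.
rewrite /computes_within iterD E0; split; first exact: reduction_halts.
by have [_ _ ->] := reduction_simulates A (reduced_word n rows) t; rewrite Ho.
Qed.

End Machine.

(** * Filtering the printed solutions *)

Definition not_semi (a : symbol) : bool := if a is Semi then false else true.

Lemma filter_copy o s :
  foldl filter_step (Copy, o) (bit_row s) = (Skip, o ++ bit_row s).
Proof. by elim: s o => //= d s IH o; rewrite IH -catA. Qed.

Lemma filter_skip o z :
  all not_semi z -> foldl filter_step (Skip, o) z = (Skip, o).
Proof.
by elim: z => //= -[d||] z IH // /IH; rewrite /filter_step /= cats0.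
Qed.

(** Here [b] is the bit of the centre and [z] the adjacency matrix. As [z] is free of [Semi],
    skipping ends exactly with the solution, and the filter is back in [Head]. *)
Lemma filter_word_object w b s z :
  all not_semi z -> (filter_word w).1 = Head ->
  filter_word (w ++ Bit b :: bit_row s ++ z ++ [:: Semi]) =
  (Head, (filter_word w).2 ++ bit_row s ++ [:: Semi]).
Proof.
rewrite {2}/filter_word foldl_cat -/(filter_word w) => zP.
case: (filter_word w) => q o /= ->.
rewrite {2}/filter_step cats0 foldl_cat filter_copy foldl_cat filter_skip //=.
by rewrite /filter_step /= catA.
Qed.

Lemma filter_word_objects (T : Type) (hd : T -> bool) (row : T -> seq bool)
    (tl : T -> seq symbol) (s : seq T) :
  (forall x, all not_semi (tl x)) ->
  (filter_word (flatten
     [seq Bit (hd x) :: bit_row (row x) ++ tl x ++ [:: Semi] | x <- s])).2 =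
  flatten [seq bit_row (row x) ++ [:: Semi] | x <- s].
Proof.
move=> tlP; set f := fun x => _ :: _; set h := fun x => _ ++ [:: Semi].
(* The induction needs the final state as well: each solution must be entered in [Head]. *)
suff -> : filter_word (flatten (map f s)) = (Head, flatten (map h s)) by [].
elim/last_ind: s => [|s x IH] //; rewrite !map_rcons !flatten_rcons.
by rewrite filter_word_object ?IH.
Qed.

(** * Stars and transversals *)

Definition spoke n (u : 'I_n) : {set 'I_n.+1} := [set ord0; lift ord0 u].

Lemma spoke_inj n : injective (@spoke n).
Proof.
move=> u v /setP/(_ (lift ord0 u)); rewrite !inE eqxx orbT lift_eqF /=.
by move=> /esym/eqP/lift_inj.
Qed.

Definition star_edges n (X : {set 'I_n}) : {set {set 'I_n.+1}} :=
  [set spoke u | u in X].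

Lemma spoke_star_edges n (X : {set 'I_n}) u :
  (spoke u \in star_edges X) = (u \in X).
Proof. exact/mem_imset/spoke_inj. Qed.

Lemma center_loopN n (X : {set 'I_n}) : ([set ord0; ord0] \in star_edges X) = false.
Proof.
apply/negP => /imsetP[u _] /setP/(_ (lift ord0 u)).
by rewrite !inE eqxx orbT lift_eqF.
Qed.

Lemma leaf_edgeN n (X : {set 'I_n}) u v :
  ([set lift ord0 u; lift ord0 v] \in star_edges X) = false.
Proof.
apply/negP => /imsetP[w _] /setP/(_ ord0).
by rewrite !inE !eq_liftF eqxx.
Qed.

Lemma star_edges_card2 n e : e \in star_edges [set: 'I_n] -> #|e| = 2.
Proof. by move=> /imsetP[u _ ->]; rewrite cards2 eq_liftF. Qed.

Section Reduction.
Variable H : hypergraph.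

Notation n := (hg_order H).

Definition star_instance : gst_instance :=
  @GSTInstance n.+1 (Graph (@star_edges_card2 n))
    ([set ord0] :: [seq lift ord0 @: (e : {set 'I_n}) | e <- hyperedges H]).

(* The vertex set is the union of the edges so that it is empty, as it must be
   for a hypergraph without hyperedges, when [X] is empty. *)
Definition star (X : {set 'I_n}) : pregraph n.+1 :=
  (cover (star_edges X), star_edges X).

Definition spokes (K : pregraph n.+1) : {set 'I_n} := [set u | spoke u \in K.2].

(** The filter prints what the vertex set shows, whereas connectivity is argued on edges through
    [spokes]; the two agree on stars. *)
Definition leaves (K : pregraph n.+1) : {set 'I_n} :=
  [set u | lift ord0 u \in K.1].

Lemma spokes_star X : spokes (star X) = X.
Proof. by apply/setP => u; rewrite inE spoke_star_edges. Qed.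

Lemma leaf_star X u : (lift ord0 u \in (star X).1) = (u \in X).
Proof.
apply/bigcupP/idP => [[e /imsetP[v vX ->]]|uX].
  by rewrite !inE lift_eqF => /eqP/lift_inj ->.
by exists (spoke u); rewrite ?spoke_star_edges // !inE eqxx orbT.
Qed.

Lemma leaves_star X : leaves (star X) = X.
Proof. by apply/setP => u; rewrite inE leaf_star. Qed.

Lemma center_star (X : {set 'I_n}) u : u \in X -> ord0 \in (star X).1.
Proof.
by move=> uX; apply/bigcupP; exists (spoke u); rewrite ?spoke_star_edges // !inE eqxx.
Qed.

(** A subgraph contains the ends of its edges, hence every vertex covered by its spokes. *)
Lemma star_spokes_sub K :
  is_subgraph (gst_graph star_instance) K -> pregraph_sub (star (spokes K)) K.
Proof.
move=> [_ KV]; have sub : star_edges (spokes K) \subset K.2.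
  by apply/subsetP => _ /imsetP[u + ->]; rewrite inE.
rewrite /pregraph_sub sub andbT; apply/bigcupsP => e /(subsetP sub).
exact: KV.
Qed.

(** A path from the centre to a hyperedge is not trivial, and as all edges are spokes, its last edge
    joins the centre to a leaf of that hyperedge. *)
Lemma connecting_transversal (K : pregraph (gst_order star_instance)) :
  group_connecting K -> hg_transversal (spokes K).
Proof.
move=> [[KE _] Kp]; apply/allP => e /(nthP set0) [i ilt ei].
(* Terminal set [0] is the centre alone, which shifts the index of the hyperedges by one. *)
have := Kp 0 i.+1; rewrite /= ltnS size_map => /(_ ilt).
rewrite (nth_map set0) // ei => -[x [p [/set1P ->]]].
case/lastP: p => [|p z]; first by move=> /imsetP[u _ /eqP]; rewrite eq_liftF.
rewrite last_rcons rcons_path => /imsetP[u ue ->] _ _ /andP[_ yz].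
apply/set0Pn; exists u; rewrite !inE ue andbT.
case: (unliftP ord0 (last ord0 p)) yz => [v|] -> // yz.
by have := subsetP KE _ yz; rewrite leaf_edgeN.
Qed.

Lemma transversal_connecting X :
  hg_transversal X -> @group_connecting star_instance (star X).
Proof.
move=> /allP XH; split.
  split=> [|e eX]; first exact/imsetS/subsetT.
  exact: (bigcup_sup e).
have hit i : i < size (hyperedges H) ->
    exists2 u, u \in X & u \in nth set0 (hyperedges H) i.
  move=> /(mem_nth set0)/XH/set0Pn[u]; rewrite inE => /andP[uX ue].
  by exists u.
move=> i [|j] /andP[ij]; first by [].
rewrite /= ltnS size_map => jlt; rewrite (nth_map set0) //.
have [v vX ve] := hit _ jlt.
have vS : [set ord0; lift ord0 v] \in star_edges X by rewrite spoke_star_edges.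
case: i ij => [|i] ij /=.
  exists ord0, [:: lift ord0 v]; split=> //=.
  - by rewrite set11.
  - exact: imset_f.
  - move=> x; rewrite !inE => /orP[] /eqP ->; first exact: center_star vX.
    by rewrite leaf_star.
  - by rewrite vS.
have ilt : i < size (hyperedges H) by apply: ltn_trans jlt.
rewrite (nth_map set0) //; have [u uX ue] := hit _ ilt.
have uS : [set lift ord0 u; ord0] \in star_edges X.
  by rewrite setUC spoke_star_edges.
(* If both hyperedges are hit in the same leaf, a detour through the centre would repeat it; the
   single vertex is the path. *)
have [uv|uv] := eqVneq u v.
  exists (lift ord0 u), [::]; split=> //=.
  - exact: imset_f.
  - by rewrite uv imset_f.
  - by move=> x; rewrite inE => /eqP ->; rewrite leaf_star.
exists (lift ord0 u), [:: ord0; lift ord0 v]; split=> //=.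
- exact: imset_f.
- exact: imset_f.
- by rewrite !inE lift_eqF (inj_eq lift_inj) (negbTE uv).
- move=> x; rewrite !inE => /or3P[] /eqP ->; last 1 first.
  + by rewrite leaf_star.
  + by rewrite leaf_star.
  + exact: center_star vX.
- by rewrite uS vS.
Qed.

Lemma star_mono (X Y : {set 'I_n}) : X \subset Y -> pregraph_sub (star X) (star Y).
Proof.
move=> XY; have sub : star_edges X \subset star_edges Y by apply: imsetS.
rewrite /pregraph_sub sub andbT; apply/bigcupsP => e /(subsetP sub).
exact: bigcup_sup.
Qed.

(** The star over the spokes of [K] is connecting and lies in [K], so minimality makes them equal; a
    smaller transversal would give a smaller star. *)
Lemma minimal_connecting_star (K : pregraph (gst_order star_instance)) :
  minimal_group_connecting K -> K = star (spokes K) /\ minset (@hg_transversal H) (spokes K).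
Proof.
move=> [Kc Kmin]; have KT := connecting_transversal Kc.
have KE : star (spokes K) = K.
  by apply: Kmin; [apply: transversal_connecting | apply: star_spokes_sub; case: Kc].
split=> //; apply/minsetP; split=> // Y YT YK.
have := Kmin _ (transversal_connecting YT).
rewrite -{1}KE => /(_ (star_mono YK)) YE.
by rewrite -[LHS]spokes_star YE.
Qed.

(** The spokes of a connecting [K] inside the star form a transversal within [X], hence [X] itself,
    so [K] contains the whole star. *)
Lemma star_minimal_connecting X :
  minset (@hg_transversal H) X -> @minimal_group_connecting star_instance (star X).
Proof.
move=> /minsetP[XT Xmin]; split; first exact: transversal_connecting.
move=> K Kc KX; have KT := connecting_transversal Kc.
have XE : spokes K = X.
  apply: Xmin => //; rewrite -(spokes_star X).
  apply/subsetP => u; rewrite !inE; case/andP: KX => _ /subsetP; exact.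
have := star_spokes_sub (proj1 Kc); rewrite XE => /andP[s1 s2].
case/andP: KX => k1 k2.
by case: K {Kc KT XE} s1 s2 k1 k2 => K1 K2 /= s1 s2 k1 k2;
   congr pair; apply/eqP; rewrite eqEsubset; apply/andP.
Qed.

(** * Encodings of instances and solutions *)

Definition bit_rows : seq (seq bool) :=
  [seq [seq i \in e | i <- enum 'I_n] | e : {set 'I_n} <- hyperedges H].

Lemma encode_rowE m (A : {set 'I_m}) :
  encode_row A = bit_row [seq i \in A | i <- enum 'I_m].
Proof. by rewrite /encode_row /bit_row -map_comp. Qed.

Lemma encode_row_ordS m (A : {set 'I_m.+1}) :
  encode_row A =
    bit_row ((ord0 \in A) :: [seq lift ord0 i \in A | i <- enum 'I_m]).
Proof. by rewrite encode_rowE enum_ordSl /= -map_comp. Qed.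

Lemma map_enum_const (T : Type) m (f : 'I_m -> T) (x : T) :
  f =1 (fun=> x) -> [seq f i | i <- enum 'I_m] = nseq m x.
Proof.
move=> /eq_map ->; rewrite -[in RHS](size_enum_ord m).
by elim: (enum _) => //= _ s ->.
Qed.

Lemma encode_hypergraphE :
  encode_instance (e := MinimalTransversalEnumeration) H =
    bit_row (nseq n true) ++ flatten (map bit_row bit_rows).
Proof.
rewrite /= /encode_order /bit_row map_nseq /bit_rows -map_comp.
by congr (_ ++ flatten _); apply: eq_map => e /=; rewrite encode_rowE.
Qed.

Lemma encode_star_instanceE :
  encode_instance (e := GroupSteinerTreeEnumeration) star_instance =
    reduced_word n bit_rows.
Proof.
pose row := bit_row (true :: nseq n false).
have order_word : encode_order n.+1 = bit_row (true :: nseq n true).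
  by rewrite /encode_order /bit_row -[_ :: _]/(nseq n.+1 true) map_nseq.
(* The centre is adjacent to all leaves, and each leaf to the centre only. *)
have edges_word : encode_edges (star_edges [set: 'I_n]) =
    bit_row (false :: nseq n true) ++ flatten (nseq n row).
  rewrite /encode_edges enum_ordSl map_cons -map_comp.
  rewrite -[LHS]/(encode_row _ ++ flatten _); congr (_ ++ flatten _).
    rewrite encode_row_ordS inE center_loopN; congr (bit_row (_ :: _)).
    by apply: map_enum_const => i; rewrite inE spoke_star_edges inE.
  apply: map_enum_const => i /=; rewrite encode_row_ordS inE setUC.
  rewrite spoke_star_edges inE; congr (bit_row (_ :: _)).
  by apply: map_enum_const => j; rewrite inE leaf_edgeN.
have terminals_word : flatten [seq encode_row W | W <- gst_terminals star_instance] =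
    row ++ flatten [seq bit_row (false :: s) | s <- bit_rows].
  rewrite /bit_rows map_cons -!map_comp.
  rewrite -[LHS]/(encode_row _ ++ flatten _); congr (_ ++ flatten _).
    rewrite encode_row_ordS set11; congr (bit_row (_ :: _)).
    by apply: map_enum_const => i; rewrite inE lift_eqF.
  apply: eq_map => e /=; rewrite encode_row_ordS; congr (bit_row (_ :: _)).
    by apply/negP => /imsetP[u _ /eqP]; rewrite eq_liftF.
  by apply: eq_map => i; rewrite (mem_imset _ _ lift_inj).
have rows_word : flatten (nseq n.+1 row) = flatten (nseq n row) ++ row.
  by rewrite -addn1 nseqD flatten_cat /= cats0.
rewrite /reduced_word rows_word -[LHS]/(encode_order n.+1 ++
  encode_edges (star_edges [set: 'I_n]) ++
  flatten [seq encode_row W | W <- gst_terminals star_instance]).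
by rewrite order_word edges_word terminals_word -!catA.
Qed.

(** Solutions are stars, on which [leaves] is injective, so no transversal is listed twice. *)
Lemma star_solutions (s : seq (pregraph n.+1)) :
  uniq s ->
  (forall K, K \in s <-> @minimal_group_connecting star_instance K) ->
  uniq (map leaves s) /\
  forall X, X \in map leaves s <-> minset (@hg_transversal H) X.
Proof.
move=> us sP; split.
  rewrite map_inj_in_uniq // => K L /sP/minimal_connecting_star[-> _].
  by move=> /sP/minimal_connecting_star[-> _]; rewrite !leaves_star => ->.
move=> X; split=> [/mapP[K /sP/minimal_connecting_star[KE KT] ->]|XT].
  by rewrite KE leaves_star.
apply/mapP; exists (star X); last by rewrite leaves_star.
exact/sP/star_minimal_connecting.
Qed.

(** The row of the vertex set without its first bit is the row of [leaves K], whatever the edges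
    are. *)
Lemma filter_word_solutions (s : seq (pregraph n.+1)) :
  (filter_word (flatten
    [seq encode_object (e := GroupSteinerTreeEnumeration) (x := star_instance) K
    | K <- s])).2 =
  flatten [seq encode_object (e := MinimalTransversalEnumeration) (x := H) X
          | X <- map leaves s].
Proof.
have edges_semi (K : pregraph n.+1) : all not_semi (encode_edges K.2).
  rewrite /encode_edges; elim: (enum _) => //= i r; rewrite all_cat => ->.
  by rewrite andbT all_rcons all_map; apply/allP.
have := filter_word_objects (fun K : pregraph n.+1 => ord0 \in K.1)
  (fun K : pregraph n.+1 => [seq lift ord0 i \in K.1 | i <- enum 'I_n]) s edges_semi.
rewrite -map_comp => EH.
have -> : [seq encode_object (e := GroupSteinerTreeEnumeration)
             (x := star_instance) K | K <- s] =
    [seq Bit (ord0 \in K.1) ::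
         bit_row [seq lift ord0 i \in K.1 | i <- enum 'I_n] ++
         encode_edges K.2 ++ [:: Semi] | K : pregraph n.+1 <- s].
  by apply: eq_map => K; rewrite /= encode_row_ordS.
rewrite EH; congr flatten; apply: eq_map => K; rewrite /= encode_rowE.
by congr (bit_row _ ++ _); apply: eq_map => i; rewrite inE.
Qed.

End Reduction.

(** * The time bound *)

Lemma horner_nat_mono (p : {poly nat}) a b : a <= b -> p.[a]%R <= p.[b]%R.
Proof.
move=> ab; rewrite !horner_coef; apply: leq_sum => i _.
by apply: leq_mul => //; elim: (nat_of_ord i) => // k IH; rewrite !GRing.exprS leq_mul.
Qed.

Theorem theorem6p2 :
  has_output_polynomial_algorithm GroupSteinerTreeEnumeration ->
  has_output_polynomial_algorithm MinimalTransversalEnumeration.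
Proof.
move=> [M [p pM]]; exists (reduction_machine M).
pose sq : {poly nat} := (('X + 1%:P) ^+ 2)%R.
have sqE x : (sq.[x])%R = (x + 1) ^ 2.
  by rewrite horner_exp hornerD hornerX hornerC.
(* The first summand pays for writing the star instance. In the second, [3 (x + 1)^2] bounds the
   length of that instance and ['X] its number of solutions, [x] being the input size plus this
   number. *)
exists (8%N *: sq + (p \Po (3%N *: sq + 'X)))%R => H.
have [s [us sP [t tp tM]]] := pM (star_instance H).
have [us' sP'] := star_solutions us sP.
exists (map (@leaves H) s); split=> //; rewrite size_map.
set N := size (encode_instance _).
have EN : N = size (bit_row (nseq (hg_order H) true) ++
                    flatten (map bit_row (bit_rows H))).
  by rewrite -encode_hypergraphE.
rewrite encode_star_instanceE in tp tM.
have [t' t'N t'M] := reduction_computes EN tM.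
exists t'; last first.
  by rewrite encode_hypergraphE -filter_word_solutions.
apply: (leq_trans t'N).
rewrite hornerD horner_comp hornerD !hornerZ hornerX sqE; apply: leq_add.
  by rewrite leq_mul2l /= leq_sqr leq_add2r leq_addr.
apply: (leq_trans tp); apply/horner_nat_mono/leq_add; last exact: leq_addl.
apply: (leq_trans (size_reduced_word EN)).
by rewrite leq_mul2l /= leq_sqr leq_add2r leq_addr.
Qed.
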